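(* Suppose that $ABCD$ is a convex quadrilateral with $\angle ABC=\angle CDA=\frac{\pi}{2}$. Then $ABCD$ is exceptional. It is determined up to congruence by the following four measurements: $|AB|$, $|AD|$, $|AC|$, and $\angle BCD$. That is, every quadrilateral $A'B'C'D'$ in the plane with $|A'B'|=|AB|$, $|A'D'|=|AD|$, $|A'C'|=|AC|$ and $\angle B'C'D'=\angle BCD$ is congruent to $ABCD$ (with vertices corresponding in the given order).
   Context: A quadrilateral $A'B'C'D'$ is given by its sequence of four distinct vertices in the plane. For a convex polygon $A_1A_2\cdots A_n$ (or more generally a sequence of distinct points in the plane), the simple measurements are: (1) distances $|A_iA_j|$, $i\ne j$; (2) angles $\angle A_iA_jA_k\in[0,\pi]$ for $i,j,k$ distinct; (3) ''diagonal angles'' between $A_iA_j$ and $A_kA_l$. An $n$-gon is called exceptional if it can be described locally (that is, determined up to isometry among all sufficiently nearby sequences of $n$ points) by fewer than $2n-3$ simple measurements; for quadrilaterals this means fewer than $5$. *)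

(* Defs.v *)
From HB Require Import structures.
From mathcomp Require Import all_boot all_order all_algebra.
From mathcomp Require Import reals trigo.

Set Implicit Arguments.
Unset Strict Implicit.
Unset Printing Implicit Defensive.

Import Order.TTheory GRing.Theory Num.Theory.

Local Open Scope ring_scope.

Section Plane.
Variable R : realType.

(* The library's norm on 'rV[R]_2 is the sup norm, so the Euclidean structure
   is defined here and the library norm is never used on points. *)
Definition plane := 'rV[R]_2.

Implicit Types (u v : plane) (P Q S : plane).

Definition dot u v : R := (u *m v^T) 0 0.

Definition norm2 u : R := Num.sqrt (dot u u).

Definition dist P Q : R := norm2 (Q - P).

(* In [0, pi] by Cauchy-Schwarz; meaningful only for nonzero u and v. *)
Definition vangle u v : R := acos (dot u v / (norm2 u * norm2 v)).

(* The angle PQS, with vertex Q. *)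
Definition angle P Q S : R := vangle (P - Q) (S - Q).

(* Positive iff P, Q, S are in counterclockwise order, zero iff collinear. *)
Definition orient P Q S : R :=
  (Q - P) 0 0 * (S - P) 0 1 - (Q - P) 0 1 * (S - P) 0 0.

Definition plane_isometry (f : plane -> plane) : Prop :=
  forall P Q, dist (f P) (f Q) = dist P Q.

Section Polygon.
Variable n : nat.

Implicit Types (p q : n.-tuple plane).

Definition same_strict_side P Q S T : Prop :=
  0 < orient P Q S * orient P Q T.

(* Every side p_i p_(i+1) (indices modulo n) leaves all the other vertices
   strictly on one side of its line; j = k is allowed, so that no other vertex
   is on that line. *)
Definition convex_polygon p : Prop :=
  [/\ (2 < n)%N, uniq p &
      forall i j k : 'I_n,
        j != i -> j != ordS i -> k != i -> k != ordS i ->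
        same_strict_side (tnth p i) (tnth p (ordS i)) (tnth p j) (tnth p k)].

(* Orientation-reversing isometries are allowed. *)
Definition congruent p q : Prop :=
  exists2 f : plane -> plane, plane_isometry f &
    forall i : 'I_n, tnth q i = f (tnth p i).

Inductive measurement : Type :=
  | Dist of 'I_n & 'I_n
  | Angle of 'I_n & 'I_n & 'I_n
  | DiagAngle of 'I_n & 'I_n & 'I_n & 'I_n.

Definition simple_measurement (m : measurement) : bool :=
  match m with
  | Dist i j => uniq [:: i; j]
  | Angle i j k => uniq [:: i; j; k]
  | DiagAngle i j k l => uniq [:: i; j; k; l]
  end.

(* The diagonal angle is taken in [0, pi], between the vectors p_i p_j and
   p_k p_l. *)
Definition measure p (m : measurement) : R :=
  match m with
  | Dist i j => dist (tnth p i) (tnth p j)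
  | Angle i j k => angle (tnth p i) (tnth p j) (tnth p k)
  | DiagAngle i j k l => vangle (tnth p j - tnth p i) (tnth p l - tnth p k)
  end.

Definition locally_determined_by p (ms : seq measurement) : Prop :=
  exists2 e : R, 0 < e &
    forall q, (forall i : 'I_n, dist (tnth p i) (tnth q i) < e) ->
      all (fun m => measure q m == measure p m) ms ->
      congruent p q.

Definition exceptional p : Prop :=
  exists ms : seq measurement,
    [/\ all simple_measurement ms, (size ms < 2 * n - 3)%N &
        locally_determined_by p ms].

End Polygon.
End Plane.

(* Main.v *)
Require Import Defs.
From HB Require Import structures.
From mathcomp Require Import all_boot all_order all_algebra.
From mathcomp Require Import reals trigo.
From mathcomp Require Import ring lra.

Set Implicit Arguments.
Unset Strict Implicit.
Unset Printing Implicit Defensive.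

Import Order.TTheory GRing.Theory Num.Theory.

Local Open Scope ring_scope.

(* Put the origin at C and let u, v, w be the vectors to B, D, A, with
   a = |AB|, b = |BC|, c = |CD|, d = |AD|, so a^2 + b^2 = c^2 + d^2 = |w|^2.
   In any competing quadrilateral, 2 <u', w'> = |u'|^2 + b^2 >= 2 b |u'|, hence
   |u' x w'| <= a |u'|, and similarly for v'.  Therefore
     |w'|^2 <u', v'> = <u', w'> <v', w'> + (u' x w') (v' x w')
                    >= |u'| |v'| (b c - a d):
   the angle at C is at most its value in ABCD, with equality only if
   |u'| = b, |v'| = c and the two cross products have opposite signs.  The inner
   and cross products with w' are then those of ABCD up to a common sign. *)

(** * Inner product, cross product and angle in the plane *)

Section PlaneVectors.
Variable R : realType.
Implicit Types (u v w z : plane R).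

Definition cross u v : R := u 0 0 * v 0 1 - u 0 1 * v 0 0.

Lemma dotE u v : dot u v = u 0 0 * v 0 0 + u 0 1 * v 0 1.
Proof.
rewrite /dot mxE big_ord_recr big_ord_recr big_ord0 /= add0r !mxE.
by congr (u _ _ * v _ _ + u _ _ * v _ _); apply: val_inj.
Qed.

Lemma dot_ge0 u : 0 <= dot u u.
Proof. by rewrite dotE -!expr2 addr_ge0 ?sqr_ge0. Qed.

Lemma norm2_ge0 u : 0 <= norm2 u.
Proof. exact: sqrtr_ge0. Qed.

Lemma sqr_norm2 u : norm2 u ^+ 2 = dot u u.
Proof. exact/sqr_sqrtr/dot_ge0. Qed.

(** Expansion of [u] and [v] in the orthogonal frame formed by [w] and its quarter turn. Taking [u]
    and [v] equal gives Lagrange's identity, hence Cauchy-Schwarz. *)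
Lemma dot_cross_decomp u v w :
  dot u v * dot w w = dot u w * dot v w + cross u w * cross v w.
Proof. by rewrite !dotE /cross; ring. Qed.

Lemma dotBB u v : dot (u - v) (u - v) = dot u u - 2 * dot v u + dot v v.
Proof. by rewrite !dotE !mxE; ring. Qed.

Lemma plane_eq u v : u 0 0 = v 0 0 -> u 0 1 = v 0 1 -> u = v.
Proof.
move=> h0 h1; apply/rowP => -[[|[|//]] hi].
  by have -> : Ordinal hi = 0 by apply: val_inj.
by have -> : Ordinal hi = 1 by apply: val_inj.
Qed.

Lemma norm2_gt0 u : (0 < norm2 u) = (u != 0).
Proof.
rewrite lt0r norm2_ge0 andbT; congr negb.
rewrite -[norm2 u == 0]sqrf_eq0 sqr_norm2 dotE -!expr2.
rewrite paddr_eq0 ?sqr_ge0 // !sqrf_eq0.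
apply/andP/eqP => [[/eqP h0 /eqP h1]|->]; last by rewrite !mxE.
by apply: plane_eq; rewrite mxE.
Qed.

Lemma cross_neq0 u w : cross u w != 0 -> 0 < norm2 u.
Proof.
by rewrite norm2_gt0; apply: contraNneq => ->; rewrite /cross !mxE !mul0r subrr.
Qed.

Lemma dot_neq0 u w : dot u w != 0 -> 0 < norm2 u.
Proof.
by rewrite norm2_gt0; apply: contraNneq => ->; rewrite dotE !mxE !mul0r addr0.
Qed.

Lemma cos_vangle u v : 0 < norm2 u -> 0 < norm2 v ->
  cos (vangle u v) = dot u v / (norm2 u * norm2 v).
Proof.
move=> u0 v0; apply: acosK; rewrite in_itv /= -ler_norml.
have uv0 : 0 < norm2 u * norm2 v by apply: mulr_gt0.
rewrite normrM normfV (gtr0_norm uv0) ler_pdivrMr // mul1r.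
rewrite -ler_sqr ?nnegrE ?normr_ge0 ?(ltW uv0) //.
rewrite real_normK ?num_real // exprMn !sqr_norm2 dot_cross_decomp.
by rewrite -!expr2 lerDl sqr_ge0.
Qed.

Lemma vangle_right u v : 0 < norm2 u -> 0 < norm2 v ->
  vangle u v = pi / 2 -> dot u v = 0.
Proof.
move=> u0 v0 h; have := cos_vangle u0 v0; rewrite h cos_pihalf.
by move/esym/eqP; rewrite mulf_eq0 invr_eq0 (gt_eqF (mulr_gt0 u0 v0)) orbF
  => /eqP.
Qed.

End PlaneVectors.

(** * Rigidity of two right triangles on opposite sides of a common hypotenuse *)

Section Rigidity.
Variable R : realType.
Implicit Types (u v w z : plane R).

(** Scalar core of the equality case: [n] and [m] are the competing lengths |u'| and |v'|, while
    [x], [y] and [X], [Y] are the inner and cross products with w'. The last hypothesis says that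
    the lower bound for the inner product of u' and v' is attained, so every loss in it vanishes. *)
Lemma angle_excess_tight (a b c d n m x y X Y : R) :
  0 < a -> 0 < b -> 0 < c -> 0 < d -> 0 < n -> 0 < m ->
  2 * x = n ^+ 2 + b ^+ 2 -> 2 * y = m ^+ 2 + c ^+ 2 ->
  X ^+ 2 + x ^+ 2 = n ^+ 2 * (a ^+ 2 + b ^+ 2) ->
  Y ^+ 2 + y ^+ 2 = m ^+ 2 * (c ^+ 2 + d ^+ 2) ->
  x * y + X * Y = n * m * (b * c - a * d) ->
  n = b /\ m = c.
Proof.
move=> a0 b0 c0 d0 n0 m0 hx hy hX hY h.
(* The defects in the AM-GM bounds [n * b <= x] and [m * c <= y]. *)
pose s := (n - b) ^+ 2 / 2; pose t := (m - c) ^+ 2 / 2.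
have s0 : 0 <= s by rewrite divr_ge0 ?sqr_ge0.
have t0 : 0 <= t by rewrite divr_ge0 ?sqr_ge0.
have xE : x = n * b + s by rewrite /s; lra.
have yE : y = m * c + t by rewrite /t; lra.
have na0 := mulr_ge0 (ltW n0) (ltW a0); have nb0 := mulr_ge0 (ltW n0) (ltW b0).
have mc0 := mulr_ge0 (ltW m0) (ltW c0); have md0 := mulr_ge0 (ltW m0) (ltW d0).
have Xle : `|X| <= n * a.
  rewrite -ler_sqr ?nnegrE // real_normK ?num_real //.
  have : (n * b) ^+ 2 <= x ^+ 2 by rewrite xE ler_sqr ?nnegrE ?addr_ge0 // lerDl.
  by rewrite !exprMn; lra.
have Yle : `|Y| <= m * d.
  rewrite -ler_sqr ?nnegrE // real_normK ?num_real //.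
  have : (m * c) ^+ 2 <= y ^+ 2 by rewrite yE ler_sqr ?nnegrE ?addr_ge0 // lerDl.
  by rewrite !exprMn; lra.
have XYge : - (n * a * (m * d)) <= X * Y.
  have : `|X * Y| <= n * a * (m * d) by rewrite normrM ler_pM.
  by rewrite ler_norml => /andP[].
have st0 : 0 <= s * t by rewrite mulr_ge0.
have nt0 : 0 <= n * b * t by rewrite mulr_ge0.
have ms0 : 0 <= m * c * s by rewrite mulr_ge0.
have sum : x * y = n * m * (b * c) + n * b * t + m * c * s + s * t.
  by rewrite xE yE; ring.
(* By [sum], [h] and [XYge], the nonnegative terms [n * b * t], [m * c * s] and [s * t] have a sum
   that is at most 0. *)
have /eqP : n * b * t = 0 by lra.
rewrite mulf_eq0 (gt_eqF (mulr_gt0 n0 b0)) /= mulf_eq0 invr_eq0 pnatr_eq0 orbF.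
rewrite sqrf_eq0 subr_eq0 => /eqP mc.
have /eqP : m * c * s = 0 by lra.
rewrite mulf_eq0 (gt_eqF (mulr_gt0 m0 c0)) /= mulf_eq0 invr_eq0 pnatr_eq0 orbF.
by rewrite sqrf_eq0 subr_eq0 => /eqP.
Qed.

(** The hypothesis makes [u] and [w - u] orthogonal, so both sides are the square of twice the area
    of a right triangle with these legs. *)
Lemma cross_right_triangle u w :
  dot u w = dot u u -> cross u w ^+ 2 = (norm2 (u - w) * norm2 u) ^+ 2.
Proof.
move=> h; have := dot_cross_decomp u u w; rewrite exprMn !sqr_norm2 dotBB.
by rewrite [dot w u]dotE !(mulrC (w _ _)) -dotE h expr2 => e; lra.
Qed.

Lemma opposite_right_triangles_rigid u0 v0 w0 u v w :
  dot u0 w0 = dot u0 u0 -> dot v0 w0 = dot v0 v0 ->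
  cross u0 w0 * cross v0 w0 < 0 ->
  norm2 (u - w) = norm2 (u0 - w0) -> norm2 (v - w) = norm2 (v0 - w0) ->
  norm2 w = norm2 w0 -> vangle u v = vangle u0 v0 ->
  [/\ dot u w = dot u0 w0, dot v w = dot v0 w0 &
      exists2 e : R, e ^+ 2 = 1 &
        cross u w = e * cross u0 w0 /\ cross v w = e * cross v0 w0].
Proof.
move=> hu0 hv0 opp hu hv hw hang.
have X0 : cross u0 w0 != 0 by apply: contraTneq opp => ->; rewrite mul0r ltxx.
have Y0 : cross v0 w0 != 0 by apply: contraTneq opp => ->; rewrite mulr0 ltxx.
have b0 := cross_neq0 X0; have c0 := cross_neq0 Y0.
have X0E := cross_right_triangle hu0; have Y0E := cross_right_triangle hv0.
have a0 : 0 < norm2 (u0 - w0).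
  rewrite lt0r norm2_ge0 andbT; apply: contraNneq X0 => h.
  by rewrite -sqrf_eq0 X0E h mul0r expr0n.
have d0 : 0 < norm2 (v0 - w0).
  rewrite lt0r norm2_ge0 andbT; apply: contraNneq Y0 => h.
  by rewrite -sqrf_eq0 Y0E h mul0r expr0n.
have hL : dot w w = dot w0 w0 by rewrite -!sqr_norm2 hw.
have dotC z z' : dot z z' = dot z' z by rewrite !dotE !(mulrC (z _ _)).
have pyth z : dot z w0 = dot z z ->
    dot w0 w0 = norm2 (z - w0) ^+ 2 + norm2 z ^+ 2.
  by move=> h; rewrite !sqr_norm2 dotBB (dotC w0) h; ring.
have Lu := pyth _ hu0; have Lv := pyth _ hv0.
(* Law of cosines, with the right angle in the reference triangle. *)
have half z z0 : dot z0 w0 = dot z0 z0 -> norm2 (z - w) = norm2 (z0 - w0) ->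
    2 * dot z w = norm2 z ^+ 2 + norm2 z0 ^+ 2.
  move=> h0 h; have : dot (z - w) (z - w) = dot (z0 - w0) (z0 - w0).
    by rewrite -!sqr_norm2 h.
  by rewrite !sqr_norm2 !dotBB (dotC w) (dotC w0) h0 hL => e; lra.
have hx := half _ _ hu0 hu; have hy := half _ _ hv0 hv.
(* A positive inner product with [w] excludes [u = 0], so the angle hypothesis does determine a
   cosine. *)
have n0 : 0 < norm2 u.
  apply: (@dot_neq0 _ u w); rewrite gt_eqF // -(pmulr_rgt0 _ (ltr0n R 2)) hx.
  by rewrite ltr_wpDl ?sqr_ge0 ?exprn_gt0.
have m0 : 0 < norm2 v.
  apply: (@dot_neq0 _ v w); rewrite gt_eqF // -(pmulr_rgt0 _ (ltr0n R 2)) hy.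
  by rewrite ltr_wpDl ?sqr_ge0 ?exprn_gt0.
(* The areas fix this product up to sign; [opp] selects the negative one. *)
have XY0 : cross u0 w0 * cross v0 w0 =
    - (norm2 (u0 - w0) * norm2 u0 * (norm2 (v0 - w0) * norm2 v0)).
  apply/eqP; rewrite -subr_eq0 opprK.
  have /eqP : (cross u0 w0 * cross v0 w0) ^+ 2 =
      (norm2 (u0 - w0) * norm2 u0 * (norm2 (v0 - w0) * norm2 v0)) ^+ 2.
    by rewrite exprMn X0E Y0E -exprMn.
  rewrite eqf_sqr -[_ == - _]subr_eq0 opprK => /orP[/eqP h|//].
  by move: opp; rewrite h ltNge !mulr_ge0 ?norm2_ge0.
have sxy z z' : cross z w ^+ 2 + dot z w ^+ 2 = norm2 z ^+ 2 * dot w w.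
  by rewrite sqr_norm2 dot_cross_decomp addrC -!expr2.
have hX := sxy u u; have hY := sxy v v.
rewrite hL {1}Lu in hX; rewrite hL {1}Lv addrC in hY.
have hcos : dot u v / (norm2 u * norm2 v) = dot u0 v0 / (norm2 u0 * norm2 v0).
  by rewrite -!cos_vangle // hang.
(* Equality of the cosines, scaled by |w|^2 and expanded along [w] and [w0]. *)
have main : dot u w * dot v w + cross u w * cross v w =
    norm2 u * norm2 v * (norm2 u0 * norm2 v0 - norm2 (u0 - w0) * norm2 (v0 - w0)).
  have nm0 : norm2 u * norm2 v != 0 by rewrite gt_eqF ?mulr_gt0.
  have bc0 : norm2 u0 * norm2 v0 != 0 by rewrite gt_eqF ?mulr_gt0.
  have h : dot u v = dot u0 v0 / (norm2 u0 * norm2 v0) * (norm2 u * norm2 v).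
    by rewrite -hcos divfK.
  rewrite -dot_cross_decomp hL h mulrAC [_ * _ * dot w0 w0]mulrAC.
  rewrite dot_cross_decomp XY0 hu0 hv0 -!sqr_norm2.
  by field; rewrite !gt_eqF.
have [nb mc] : norm2 u = norm2 u0 /\ norm2 v = norm2 v0.
  apply: (angle_excess_tight a0 b0 c0 d0 n0 m0 hx hy hX _ main).
  by rewrite addrC hY addrC.
have ex : dot u w = dot u0 w0 by rewrite hu0 -sqr_norm2; move: hx; rewrite nb; lra.
have ey : dot v w = dot v0 w0 by rewrite hv0 -sqr_norm2; move: hy; rewrite mc; lra.
have XYE : cross u w * cross v w = cross u0 w0 * cross v0 w0.
  by rewrite XY0; move: main; rewrite ex ey hu0 hv0 -!sqr_norm2 nb mc; lra.
have XE : cross u w ^+ 2 = cross u0 w0 ^+ 2.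
  by rewrite X0E exprMn; move: hX; rewrite ex hu0 -!sqr_norm2 nb; lra.
(* This ratio is 1 or -1, since the squares agree; the value -1 is the mirror image. *)
split=> //; exists (cross u w / cross u0 w0).
  by rewrite exprMn XE exprVn divff ?sqrf_eq0.
split; first by rewrite divfK.
have X1 : cross u w != 0 by rewrite -sqrf_eq0 XE sqrf_eq0.
apply: (mulfI X1); apply: (mulfI X0).
rewrite XYE; transitivity (cross u w ^+ 2 * cross v0 w0); last by field.
by rewrite XE; ring.
Qed.

(** The congruence carries [P] to [Q]. Its linear part sends [w0] to [w] and the quarter turn of
    [w0] to [e] times that of [w], so it is a rotation or a reflection according to [e]. *)
Lemma congruent_of_frame e u0 v0 w0 u v w (P Q : plane R) :
  w0 != 0 -> dot w w = dot w0 w0 -> e ^+ 2 = 1 ->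
  dot u w = dot u0 w0 -> dot v w = dot v0 w0 ->
  cross u w = e * cross u0 w0 -> cross v w = e * cross v0 w0 ->
  congruent [tuple P + w0; P + u0; P; P + v0] [tuple Q + w; Q + u; Q; Q + v].
Proof.
rewrite -norm2_gt0 => w0_gt0 hL e1 hu hv cu cv.
have L0 : dot w w != 0 by rewrite hL -sqr_norm2 gt_eqF ?exprn_gt0.
(* The clockwise quarter turn, for which [dot z (rot w) = cross z w]. *)
pose rot (w : plane R) : plane R := \row_j (if j == 0 then w 0 1 else - w 0 0).
pose g z : plane R := (dot w w)^-1 *: (dot z w0 *: w + (e * cross z w0) *: rot w).
have gE z z0 : dot z w = dot z0 w0 -> cross z w = e * cross z0 w0 -> g z0 = z.
  move=> h1 h2; rewrite /g -h1 -h2; move: L0; rewrite !dotE => L0.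
  by apply: plane_eq; rewrite !mxE /cross /=; field.
have gB z z' : g z - g z' = g (z - z').
  by apply: plane_eq; rewrite !mxE !dotE /cross !mxE; ring.
have g_dot z : dot (g z) (g z) = dot z z.
  have -> : dot (g z) (g z) =
      (dot z w0 * dot z w0 + e ^+ 2 * (cross z w0 * cross z w0)) / dot w w.
    move: L0; rewrite [dot (g z) _]dotE !mxE /= ![dot w w]dotE => L0.
    by field.
  by rewrite e1 mul1r -dot_cross_decomp -hL mulfK.
have g0 : g 0 = 0 by rewrite -[0 in LHS](subrr 0) -gB subrr.
exists (fun S => Q + g (S - P)).
  move=> S T; rewrite /dist /norm2 opprD addrACA subrr add0r gB g_dot.
  by rewrite opprB addrA subrK.
case=> -[|[|[|[|//]]]] hi; rewrite /tnth /= ?subrr ?g0 ?addr0 //;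
  rewrite addrAC subrr add0r; congr (_ + _); apply/esym/gE => //.
- by rewrite /cross; ring.
Qed.

End Rigidity.

(** * From the quadrilateral to vectors based at C *)

Section Quadrilateral.
Variable R : realType.
Implicit Types A B C D : plane R.

Lemma distC A B : dist A B = dist B A.
Proof.
by rewrite /dist /norm2 !dotE !mxE; congr Num.sqrt; ring.
Qed.

(** B and D lie on opposite sides of the diagonal AC: convexity at the sides BC and CD gives the
    triangles BCA and CDA both the orientation of BCD. *)
Lemma convex_quadrilateral_diagonal A B C D :
  convex_polygon [tuple A; B; C; D] ->
  cross (B - C) (A - C) * cross (D - C) (A - C) < 0.
Proof.
case=> _ _ side.
pose o (k : nat) (hk : (k < 4)%N) := Ordinal hk.
have : same_strict_side B C D A.
  exact: (side (@o 1 isT) (@o 3 isT) (@o 0 isT)).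
have : same_strict_side C D A B.
  exact: (side (@o 2 isT) (@o 0 isT) (@o 1 isT)).
rewrite /same_strict_side => h1 h2.
have BCA : orient B C A = - cross (B - C) (A - C).
  by rewrite /orient /cross !mxE; ring.
have CDB : orient C D B = orient B C D by rewrite /orient !mxE; ring.
have CDA : orient C D A = cross (D - C) (A - C) by [].
move: h1 h2; rewrite CDB CDA BCA => h1 h2.
have := mulr_gt0 h1 h2.
rewrite (_ : _ * _ =
  - (cross (B - C) (A - C) * cross (D - C) (A - C)) * orient B C D ^+ 2);
  last by ring.
move=> h; have := lt0r_neq0 h; rewrite mulf_eq0 negb_or => /andP[_ sq0].
by move: h; rewrite pmulr_lgt0 ?oppr_gt0 // lt0r sq0 sqr_ge0.
Qed.

(** With a right angle at B, the orthogonal projection of A on the line CB is B. *)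
Lemma right_angle_dot A B C :
  A != B -> C != B -> angle A B C = pi / 2 ->
  dot (B - C) (A - C) = dot (B - C) (B - C).
Proof.
rewrite -(subr_eq0 A) -(subr_eq0 C) -!norm2_gt0 => AB CB.
by move/(vangle_right AB CB); rewrite !dotE !mxE; lra.
Qed.

Lemma congruent_of_four_measurements A B C D A' B' C' D' :
  convex_polygon [tuple A; B; C; D] ->
  angle A B C = pi / 2 -> angle C D A = pi / 2 ->
  dist A' B' = dist A B -> dist A' D' = dist A D -> dist A' C' = dist A C ->
  angle B' C' D' = angle B C D ->
  congruent [tuple A; B; C; D] [tuple A'; B'; C'; D'].
Proof.
move=> conv hB hD AB AD AC BCD.
have opp := convex_quadrilateral_diagonal conv.
case: conv => _ /=; rewrite !inE !negb_or.
move=> /andP[/and3P[nAB nAC nAD] /andP[/andP[nBC nBD] /andP[nCD _]]] _.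
have rB : dot (B - C) (A - C) = dot (B - C) (B - C).
  by apply: right_angle_dot; rewrite // eq_sym.
have rD : dot (D - C) (A - C) = dot (D - C) (D - C).
  apply: right_angle_dot => //.
  (* The angle at D is given as CDA but used as ADC. *)
  move: hD; rewrite /angle /vangle => <-; congr acos.
  by rewrite [norm2 (A - D) * _]mulrC !dotE; congr (_ / _); ring.
have sub (P Q S : plane R) : P - S - (Q - S) = P - Q.
  by rewrite opprB addrA subrK.
have [|||| hx hy [e e1 [cx cy]]] :=
  opposite_right_triangles_rigid rB rD opp (u := B' - C') (v := D' - C')
    (w := A' - C').
- by rewrite !sub.
- by rewrite !sub.
- by rewrite -[LHS]/(dist C' A') distC AC distC.
- exact: BCD.
have w0 : A - C != 0 by rewrite subr_eq0.
have hL : dot (A' - C') (A' - C') = dot (A - C) (A - C).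
  by rewrite -!sqr_norm2 -[norm2 _]/(dist C' A') distC AC distC.
have := congruent_of_frame C C' w0 hL e1 hx hy cx cy.
by rewrite !(addrC C) !(addrC C') !subrK.
Qed.

End Quadrilateral.

Theorem proposition3p6 (R : realType) (A B C D : plane R)
    (hconvex : convex_polygon [tuple A; B; C; D])
    (hB : angle A B C = pi / 2) (hD : angle C D A = pi / 2) :
  exceptional [tuple A; B; C; D] /\
  (forall A' B' C' D' : plane R,
     uniq [:: A'; B'; C'; D'] ->
     dist A' B' = dist A B ->
     dist A' D' = dist A D ->
     dist A' C' = dist A C ->
     angle B' C' D' = angle B C D ->
     congruent [tuple A; B; C; D] [tuple A'; B'; C'; D']).
Proof.
split=> [|A' B' C' D' _]; last exact: congruent_of_four_measurements.
pose i (k : nat) (hk : (k < 4)%N) := Ordinal hk.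
pose a := @i 0 isT; pose b := @i 1 isT; pose c := @i 2 isT; pose d := @i 3 isT.
exists [:: Dist a b; Dist a d; Dist a c; Angle b c d]; split=> //.
(* The four measurements determine the quadrilateral globally, so any radius serves. *)
exists 1 => // q _ /= /and5P[/eqP AB /eqP AD /eqP AC /eqP BCD _].
rewrite (_ : q = [tuple tnth q a; tnth q b; tnth q c; tnth q d]).
  exact: congruent_of_four_measurements.
by apply: eq_from_tnth => -[[|[|[|[|//]]]] hk]; rewrite [RHS]/tnth /=;
  congr tnth; apply: val_inj.
Qed.
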